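(* Assume $\mathfrak d=\mathfrak c$. Then there exists a countable regular maximal selectively separable space.
   Context: Spaces are non-empty and regular spaces are $T_1$. $\mathfrak c$ is the cardinality of the continuum and $\mathfrak d$ is the dominating number (the minimum cardinality of a family $\mathcal{G}\subset\omega^\omega$ such that every $f\in\omega^\omega$ satisfies $f(n)\le g(n)$ for all but finitely many $n$, for some $g\in\mathcal{G}$). A space is crowded if it has no isolated points. A space is maximal if it is crowded and no strictly stronger (finer) topology on the same set is crowded. $X$ is selectively separable if for every sequence $(D_n:n\in\omega)$ of dense subspaces of $X$ one can pick finite sets $F_n\subset D_n$ so that $\bigcup_{n\in\omega}F_n$ is dense in $X$. *)

(* Defs.v *)
From HB Require Import structures.
From mathcomp Require Import all_boot all_order all_algebra.
From mathcomp Require Import all_classical all_reals all_analysis.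

Set Implicit Arguments.
Unset Strict Implicit.
Unset Printing Implicit Defensive.

Local Open Scope classical_set_scope.
Local Open Scope card_scope.

Definition eventually_le (f g : nat -> nat) : Prop :=
  finite_set [set n | ~~ (f n <= g n)%N].

Definition dominating (G : set (nat -> nat)) : Prop :=
  forall f : nat -> nat, exists2 g, G g & eventually_le f g.

(* There is no type of cardinals, so a cardinal is given by any set [A] having
   it: [A] has cardinality the dominating number when its cardinality is the
   minimum of the cardinalities of dominating families. *)
Definition card_is_dominating_number (U : Type) (A : set U) : Prop :=
  (exists2 G, dominating G & G #= A) /\
  (forall G, dominating G -> A #<= G).

Definition dominating_number_eq_continuum (R : realType) : Prop :=
  card_is_dominating_number [set: R].

Definition crowded (X : topologicalType) : Prop :=
  isolated [set: X] = set0.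

(* [tau : Topological X] is an arbitrary topological structure on the carrier
   of [X], unrelated to the given topology of [X]. *)
Definition maximal_space (X : topologicalType) : Prop :=
  crowded X /\
  ~ exists tau : Topological X,
      let Y : topologicalType := Topological.Pack tau in
      (@open X : set (set X)) `<` (@open Y : set (set X)) /\ crowded Y.

Definition selectively_separable (X : topologicalType) : Prop :=
  forall D : nat -> set X, (forall n, dense (D n)) ->
  exists F : nat -> set X,
    (forall n, finite_set (F n) /\ F n `<=` D n) /\
    dense (\bigcup_n F n).

(* Main.v *)
(** A family [C] of colorings [nat -> nat] makes [nat] a zero-dimensional space,
    the fibres of the colorings being clopen.  Starting from the residues modulo
    powers of two, which give a crowded [T1] topology, colorings are added by a
    recursion of length continuum, keeping the space crowded; before each step
    the space has weight less than the continuum, hence less than the dominating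
    number.

    Given dense sets [D_n] in such a space, one finds finite [F_n] in [D_n] whose
    union [E] splits into infinitely many dense pieces: near a point [z], finitely
    many points of [D_k] are taken in the [k]-th residue neighborhood of [z], their
    number being governed by a function that the weight is too small to dominate;
    the result accumulates at [z] only, so finitely many repetitions leave a dense
    set to choose from.  Coloring the pieces of [E] by distinct colors, and giving
    each point outside [E] the color of one piece of its own, yields a coloring with
    crowded fibres that is injective off [E]; once it is added, [E] meets every
    nonempty open set of every later crowded topology.  This gives selective
    separability and, for a constant sequence, shows that dense sets are open in
    the end.  Sets that are crowded with crowded complement are made clopen along
    the way.

    In the final space the closure of a crowded set [A] is clopen, and the union of
    [A] with the complement of its closure is dense, hence open; so [A] is open.
    A crowded finer topology consists of sets crowded in the given one, so it adds
    nothing. *)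
Require Import Defs.
From HB Require Import structures.
From mathcomp Require Import all_boot all_order all_algebra.
From mathcomp Require Import all_classical all_reals all_analysis.
From mathcomp Require Import ring lra.

Set Implicit Arguments.
Unset Strict Implicit.
Unset Printing Implicit Defensive.

Local Open Scope classical_set_scope.

(** * Well-orders with small initial segments *)

Definition strict_well_order (T : Type) (lt : T -> T -> Prop) : Prop :=
  [/\ well_founded lt, (forall x y z, lt x y -> lt y z -> lt x z) &
      forall x y, [\/ lt x y, x = y | lt y x]].

Lemma well_founded_min (T : Type) (lt : T -> T -> Prop) (P : T -> Prop) :
  well_founded lt -> (exists x, P x) ->
  exists2 x, P x & forall y, lt y x -> ~ P y.
Proof.
move=> wf [x Px]; apply: contrapT => noMin.
elim/(well_founded_ind wf): x Px => x IH Px.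
by apply: noMin; exists x => // y /IH.
Qed.

Lemma well_founded_of_min (T : Type) (lt : T -> T -> Prop) :
  (forall P : T -> Prop, (exists x, P x) ->
    exists2 x, P x & forall y, lt y x -> ~ P y) ->
  well_founded lt.
Proof.
move=> minP x; apply: contrapT => nx.
have [y ny miny] := minP (fun x => ~ Acc lt x) (ex_intro _ x nx).
by apply: ny; constructor => z /miny/contrapT.
Qed.

Lemma strict_well_order_exists (T : eqType) :
  exists lt : T -> T -> Prop, strict_well_order lt.
Proof.
have [R wR] := wochoice.well_ordering_principle T.
have minR (P : T -> Prop) : (exists x, P x) ->
    exists2 x, P x & forall y, P y -> R x y.
  move=> [x Px].
  have [|z [[Pz zmin] _]] := wR (fun x => `[< P x >]); first by exists x; exact/asboolP.
  by exists z; [exact/asboolP|move=> y Py; apply: zmin; exact/asboolP].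
have pairR x y : R x y || R y x.
  have [|z [->|->] zmin] := minR (fun z => z = x \/ z = y).
  - by exists x; left.
  - by rewrite zmin //; right.
  - by rewrite (zmin x) ?orbT //; left.
have antiR : antisymmetric R.
  by move=> x y; apply: (@wochoice.wo_chain_antisymmetric _ R predT (fun A _ => wR A)).
exists (fun x y => R x y /\ x <> y); split.
- apply: well_founded_of_min => P /minR[x Px xmin]; exists x => // y [yx neq] /xmin xy.
  by apply: neq; apply: antiR; rewrite yx xy.
- move=> x y z [xy nxy] [yz nyz].
  have [|w Pw wmin] := minR (fun w => [\/ w = x, w = y | w = z]).
  - by exists x; constructor 1.
  have xw : R w x by apply: wmin; constructor 1.
  have yw : R w y by apply: wmin; constructor 2.
  have zw : R w z by apply: wmin; constructor 3.
  case: Pw => ?; subst w.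
  - split=> // ?; subst z; apply: nxy; apply: antiR; by rewrite xy yz.
  - by case: nxy; apply: antiR; rewrite xy xw.
  - by case: nyz; apply: antiR; rewrite yz yw.
- move=> x y; have [->|nxy] := pselect (x = y); first by constructor 2.
  case/orP: (pairR x y) => h; [constructor 1|constructor 3]; split => //.
  by move/esym.
Qed.

Lemma strict_well_order_rank (T : Type) (lt : T -> T -> Prop) (rk : T -> T) :
  strict_well_order lt ->
  strict_well_order (fun x y => lt (rk x) (rk y) \/ rk x = rk y /\ lt x y).
Proof.
move=> [wf tr tri]; split.
- apply: well_founded_of_min => P [x0 Px0].
  have [|_ [x1 Px1 <-] m1] := @well_founded_min _ _ (fun r => exists2 x, P x & rk x = r) wf.
    by exists (rk x0), x0.
  have [|x [Px xr] m2] := @well_founded_min _ _ (fun x => P x /\ rk x = rk x1) wf.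
    by exists x1.
  exists x => // y [ltr|[er lty]] Py.
  - by apply: (m1 (rk y)); [rewrite -xr|exists y].
  - by apply: (m2 y lty); rewrite er.
- move=> x y z [xy|[exy xy]] [yz|[eyz yz]].
  + by left; apply: tr yz.
  + by left; rewrite -eyz.
  + by left; rewrite exy.
  + by right; rewrite exy; split=> //; apply: tr yz.
- move=> x y; case: (tri (rk x) (rk y)) => h.
  + by constructor 1; left.
  + case: (tri x y) => h'; [constructor 1|constructor 2|constructor 3] => //; right => //.
  + by constructor 3; left.
Qed.

(* [T] is not larger than the set of finite words over [nat] and [L]; for an
   infinite [L] this is equivalent to [T] being not larger than [L]. *)
Definition embeds_in_words (T : eqType) (L : set T) : Prop :=
  exists2 f : T -> seq (nat + T), injective f &
    forall t u, inr u \in f t -> L u.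

Lemma embeds_in_wordsS (T : eqType) (L M : set T) :
  L `<=` M -> embeds_in_words L -> embeds_in_words M.
Proof. by move=> LM [f fI fL]; exists f => // t u /fL/LM. Qed.

(** One extra letter costs nothing: it is recoded as the number 0 and the numbers are shifted up by
    one. *)
Lemma embeds_in_words_setU1 (T : eqType) (L : set T) (a : T) :
  embeds_in_words (a |` L) -> embeds_in_words L.
Proof.
move=> [f fI fL].
pose g (l : nat + T) : nat + T :=
  match l with inl n => inl n.+1 | inr v => if v == a then inl 0 else inr v end.
have gI : injective g.
  move=> [n|v] [m|w] /=.
  - by case=> ->.
  - by case: eqP.
  - by case: eqP.
  - by case: eqP => [->|_]; case: eqP => [->|_] // [->].
exists (map g \o f); first exact: inj_comp (inj_map gI) fI.
move=> t u /mapP[[n|v] vf] //=; case: eqP => // nva [->].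
by have [] := fL _ _ vf.
Qed.

(* Words over words are flattened by a prefix code. *)
Lemma embeds_in_words_trans (T : eqType) (L M : set T)
    (f : T -> seq (nat + T)) :
  injective f -> (forall t, L t -> forall u, inr u \in f t -> M u) ->
  embeds_in_words L -> embeds_in_words M.
Proof.
move=> fI fM [h hI hL].
pose g (l : nat + T) : seq (nat + T) :=
  match l with
  | inl n => [:: inl 0; inl n] | inr v => inl (size (f v)).+1 :: f v end.
have gI : injective (fun w => flatten (map g w)).
  elim=> [|a w IH] [|b w'] //=; [by case: b|by case: a|].
  case: a b => [n|v] [m|v'] //=; first by case=> -> /IH->.
  case=> sz /eqP; rewrite eqseq_cat // => /andP[/eqP/fI-> /eqP/IH->] //.
exists (fun t => flatten (map g (h t))); first by move=> t t' /gI/hI.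
move=> t u /flattenP[_ /mapP[[n|v] vh ->]] /=.
  by rewrite !inE.
by rewrite inE /= => uf; apply: (fM v) => //; exact: hL vh.
Qed.

Lemma word_max (T : eqType) (lt : T -> T -> Prop) (t0 : T) (w : seq (nat + T)) :
  strict_well_order lt ->
  exists2 u, u = t0 \/ inr u \in w & forall v, inr v \in w -> lt v u \/ v = u.
Proof.
move=> [_ tr tri]; elim: w => [|[n|a] w [u uw um]].
- by exists t0 => //; left.
- exists u; first by case: uw => [->|uw]; [left|right; rewrite inE uw orbT].
  by move=> v; rewrite inE /= => /um.
- have [au|au|ua] := tri a u.
  + exists u; first by case: uw => [->|uw]; [left|right; rewrite inE uw orbT].
    by move=> v; rewrite inE => /orP[/eqP[->]|/um] //; left.
  + exists u; first by right; rewrite -au mem_head.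
    by move=> v; rewrite inE => /orP[/eqP[->]|/um] //; right.
  + exists a; first by right; rewrite mem_head.
    move=> v; rewrite inE => /orP[/eqP[->]|/um[vu|->]]; [by right| |by left].
    by left; apply: tr ua.
Qed.

(* If some initial segment [L] of a well-order is too large, take the least one
   and order [T] by the largest letter of the word over [L] coding a point; this
   avoids the cardinal arithmetic [k * k = k]. *)
Lemma small_segments_well_order (T : eqType) :
  ~ embeds_in_words (@set0 T) ->
  exists2 lt : T -> T -> Prop, strict_well_order lt &
    forall t, ~ embeds_in_words [set u | lt u t].
Proof.
move=> T0; have [lt wo] := strict_well_order_exists T.
have [wf tr tri] := wo.
have [small|/existsNP[t1 /contrapT big]] :=
  pselect (forall t, ~ embeds_in_words [set u | lt u t]); first by exists lt.
have [t bigt tmin] := @well_founded_min _ _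
  (fun t => embeds_in_words [set u | lt u t]) wf (ex_intro _ t1 big).
have [t0 _ t0min] := @well_founded_min _ _ (fun=> True) wf (ex_intro _ t I).
have t0t : lt t0 t.
  have [//|e|/t0min//] := tri t0 t; case: T0; apply: embeds_in_wordsS bigt => u /=.
  by rewrite -e => /t0min.
have [f fI fL] := bigt.
have /choice[rk rkP] : forall x, exists u,
    (u = t0 \/ inr u \in f x) /\ forall v, inr v \in f x -> lt v u \/ v = u.
  by move=> x; have [u] := @word_max _ lt t0 (f x) wo; exists u.
exists (fun x y => lt (rk x) (rk y) \/ rk x = rk y /\ lt x y).
  exact: strict_well_order_rank.
move=> x segx.
have rkt : lt (rk x) t by have [[->|/fL]] := rkP x.
apply: (tmin _ rkt); apply: (@embeds_in_words_setU1 _ _ (rk x)).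
apply: embeds_in_words_trans fI _ segx => y yx u ufy.
have rkyx : lt (rk y) (rk x) \/ rk y = rk x by case: yx => [?|[]]; [left|right].
have /= := (rkP y).2 u ufy; case: rkyx => [yx'|->].
- by case=> [uy|->]; right => //=; apply: tr yx'.
- by case; [right|left].
Qed.

(** Words without letters of the type are lists of numbers, hence countably many; the diagonal set
    [A] refutes such an injection. *)
Lemma not_embeds_in_words_set0 :
  ~ embeds_in_words (@set0 (nat -> set nat)).
Proof.
move=> [f fI f0].
pose p D : nat := pickle [seq (if l is inl n then n else 0) | l <- f D].
have pI : injective p.
  move=> D D' /(pcan_inj pickleK) e; apply: fI.
  have : forall u, inr u \notin f D by move=> u; apply/negP => /f0.
  have : forall u, inr u \notin f D' by move=> u; apply/negP => /f0.
  elim: (f D) (f D') e => [|[n|u] w IH] [|[m|v] w'] //= [].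
  - by move=> -> e nw' nw; congr cons; apply: IH.
  - by move=> _ _ /(_ v); rewrite mem_head.
  - by move=> _ _ _ /(_ u); rewrite mem_head.
  - by move=> _ _ /(_ u); rewrite mem_head.
pose A : set nat := [set n | exists2 D : nat -> set nat, p D = n & ~ D 0 n].
have nA : ~ A (p (fun=> A)).
  by move=> /[dup] An [D /pI->]; apply.
by apply: (nA); exists (fun=> A).
Qed.

(** * The continuum many tasks *)

Section TernarySums.
Import Order.TTheory GRing.Theory Num.Theory.
Local Open Scope ring_scope.

Definition ternary_sum (R : realType) (x : nat -> bool) (n : nat) : R :=
  \sum_(i < n) (x i)%:R * 3^-1 ^+ i.

Lemma ternary_sum_le (R : realType) (x : nat -> bool) (n m : nat) :
  ternary_sum R x (n + m) <= ternary_sum R x n + 2^-1 * 3 * 3^-1 ^+ n * (1 - 3^-1 ^+ m).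
Proof.
elim: m => [|m IH]; first by rewrite addn0 expr0 subrr mulr0 addr0.
rewrite addnS /ternary_sum big_ord_recr /= -/(ternary_sum R x (n + m)).
have xle : (x (n + m)%N)%:R * 3^-1 ^+ (n + m) <= 3^-1 ^+ (n + m) :> R.
  by case: (x _); rewrite ?mul1r ?mul0r // exprn_ge0 // invr_ge0.
apply: le_trans (lerD IH xle) _; rewrite -/(ternary_sum R x n).
by rewrite exprD exprS le_eqVlt; apply/orP; left; apply/eqP; field.
Qed.

Lemma ternary_sum_ge (R : realType) (x : nat -> bool) (n m : nat) :
  ternary_sum R x n <= ternary_sum R x (n + m).
Proof.
elim: m => [|m IH]; first by rewrite addn0.
rewrite addnS /ternary_sum big_ord_recr /=; apply: le_trans IH _.
by rewrite lerDl mulr_ge0 // exprn_ge0 // invr_ge0.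
Qed.

Lemma ternary_sum_ub (R : realType) (x : nat -> bool) (n m : nat) :
  ternary_sum R x m <= ternary_sum R x n + 2^-1 * 3 * 3^-1 ^+ n.
Proof.
have p k : 0 <= 3^-1 ^+ k :> R by rewrite exprn_ge0 // invr_ge0.
case: (leqP m n) => [mn|/ltnW nm].
  have := ternary_sum_ge R x m (n - m); rewrite subnKC // => h.
  by apply: le_trans h _; rewrite lerDl !mulr_ge0.
have := ternary_sum_le R x n (m - n); rewrite subnKC // => h.
apply: le_trans h _; rewrite lerD2l ler_piMr ?mulr_ge0 //.
Qed.

(** With ratio 1/3, the tail after the first difference [n] is at most half of [3^-1 ^+ n], so it
    cannot make up for the digit at [n]. *)
Lemma bool_sequences_embed_reals (R : realType) :
  exists f : (nat -> bool) -> R, injective f.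
Proof.
pose f (x : nat -> bool) : R := sup (range (ternary_sum R x)).
have hs x : has_sup (range (ternary_sum R x)).
  split; first by exists (ternary_sum R x 0), 0%N.
  exists (ternary_sum R x 0 + 2^-1 * 3 * 3^-1 ^+ 0) => _ [m _ <-].
  exact: ternary_sum_ub.
have lb x n : ternary_sum R x n <= f x.
  by apply: ub_le_sup; [case: (hs x)|exists n].
have ub x n : f x <= ternary_sum R x n + 2^-1 * 3 * 3^-1 ^+ n.
  by apply: ge_sup; [case: (hs x)|move=> _ [m _ <-]; exact: ternary_sum_ub].
have lt x y n : (forall i, (i < n)%N -> x i = y i) -> x n = false -> y n = true ->
    f x < f y.
  move=> xy xn yn; apply: le_lt_trans (ub x n.+1) _; apply: lt_le_trans (lb y n.+1).
  rewrite /ternary_sum !big_ord_recr /= xn yn mul0r mul1r addr0 exprS.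
  rewrite (eq_bigr (fun i : 'I_n => (y i)%:R * 3^-1 ^+ i)); last by move=> i _; rewrite xy.
  rewrite ltrD2l.
  have : 0 < 3^-1 ^+ n :> R by rewrite exprn_gt0 // invr_gt0.
  by move: (3^-1 ^+ n) => a; lra.
exists f => x y fxy; apply: contrapT => /eqP nxy.
have ex : exists n, x n != y n.
  by apply: contrapT => nex; case/eqP: nxy; apply/funext => n;
    apply/eqP; apply: contrapT => /negP h; apply: nex; exists n.
have eqlt i : (i < ex_minn ex)%N -> x i = y i.
  by case: ex_minnP => n _ nm; apply: contraTeq => /nm; rewrite leqNgt.
move: eqlt; case: ex_minnP => n + _ eqlt.
case xn: (x n); case yn: (y n) => // _.
- have := lt y x n; rewrite fxy ltxx => h; suff: false by [].
  by apply: h => // i /eqlt.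
- by have := lt x y n eqlt xn yn; rewrite fxy ltxx.
Qed.

Lemma set_sequences_embed_reals (R : realType) :
  exists f : (nat -> set nat) -> R, injective f.
Proof.
have [f fI] := bool_sequences_embed_reals R.
exists (fun D => f (fun n => if unpickle n is Some p
                             then `[< D p.1 p.2 >] else false)).
move=> D D' /fI e; apply/funext => i; apply/funext => j; apply/propext.
by apply: asbool_eq_equiv; have := congr1 (@^~ (pickle (i, j))) e; rewrite /= !pickleK.
Qed.

End TernarySums.

(** * Topologies given by colorings *)

(* A family [C] of colorings [nat -> nat] stands for the topology on [nat]
   generated by the fibres of its members: the points [y] with [agree s x y],
   for [s] a finite sequence over [C], form a basic clopen neighborhood of
   [x]. *)
Definition agree (s : seq (nat -> nat)) (x y : nat) : bool :=
  all (fun c : nat -> nat => c y == c x) s.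

Definition over_family (C : set (nat -> nat)) (s : seq (nat -> nat)) : Prop :=
  forall c, c \in s -> C c.

Definition pow2_residue (k y : nat) : nat := y %% 2 ^ k.

Definition coloring_dense (C : set (nat -> nat)) (D : set nat) : Prop :=
  forall s x, over_family C s -> exists2 y, D y & agree s x y.

(* The fibres of [c] are crowded in the topology given by [C]: it contains the
   residues, so its neighborhoods of [x] contain arbitrarily large points as
   soon as they contain a point other than [x]. *)
Definition crowded_fibres (C : set (nat -> nat)) (c : nat -> nat) : Prop :=
  forall s x M, over_family C s -> exists y, [/\ M < y, agree s x y & c y = c x].

Definition crowded_family (C : set (nat -> nat)) : Prop :=
  crowded_fibres C (fun=> 0).

Definition membership (A : set nat) (y : nat) : nat := `[< A y >].

Definition selects (D : nat -> set nat) (c : nat -> nat) : Prop :=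
  exists2 F : nat -> set nat, (forall n, finite_set (F n) /\ F n `<=` D n) &
    forall x y, ~ (\bigcup_n F n) x -> ~ (\bigcup_n F n) y -> c x = c y -> x = y.

Definition small_family (C : set (nat -> nat)) : Prop :=
  forall f : seq (nat -> nat) -> nat -> nat, ~ dominating (f @` over_family C).

Lemma agree_refl s x : agree s x x.
Proof. by apply/allP => c _; exact: eqxx. Qed.

Lemma agree_trans s x y z : agree s x y -> agree s y z -> agree s x z.
Proof.
move=> /allP xy /allP yz; apply/allP => c cs.
by rewrite (eqP (yz c cs)) xy.
Qed.

Lemma agree_sym s x y : agree s x y -> agree s y x.
Proof. by move=> /allP xy; apply/allP => c /xy; rewrite eq_sym. Qed.

Lemma agree_cat s s' x y : agree (s ++ s') x y = agree s x y && agree s' x y.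
Proof. exact: all_cat. Qed.

Lemma over_cat C s s' : over_family C s -> over_family C s' -> over_family C (s ++ s').
Proof. by move=> h h' c; rewrite mem_cat => /orP[/h|/h']. Qed.

Lemma over_cons C c s : C c -> over_family C s -> over_family C (c :: s).
Proof. by move=> h h' d; rewrite inE => /orP[/eqP->|/h']. Qed.

Lemma over_nil C : over_family C [::].
Proof. by []. Qed.

Lemma overS C C' s : C `<=` C' -> over_family C s -> over_family C' s.
Proof. by move=> CC' h c /h/CC'. Qed.

Lemma over_setU1 C c s : over_family (c |` C) s ->
  exists2 s', over_family C s' & forall x y, agree s' x y -> c y = c x -> agree s x y.
Proof.
elim: s => [|a s IH] h; first by exists [::].
have [|s' s'C s'P] := IH; first by move=> b bs; apply: h; rewrite inE bs orbT.
have [->|aC] := h a (mem_head _ _).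
  by exists s' => // x y xy cxy; rewrite /= cxy eqxx s'P.
exists (a :: s'); first exact: over_cons.
by move=> x y /= /andP[-> /s'P xy] /xy.
Qed.

(** A number [x <= k] is below [2 ^ k], hence the least in its class. *)
Lemma pow2_residue_ge k x y :
  x <= k -> pow2_residue k y = pow2_residue k x -> x <= y.
Proof.
rewrite /pow2_residue => xk e; have x2 : x < 2 ^ k := leq_ltn_trans xk (ltn_expl k (isT : 1 < 2)).
by rewrite -(modn_small x2) -e leq_mod.
Qed.

Lemma pow2_residue_le j k x y : k <= j ->
  pow2_residue j y = pow2_residue j x -> pow2_residue k y = pow2_residue k x.
Proof.
by move=> kj; rewrite /pow2_residue => e; rewrite -(modn_dvdm y (dvdn_exp2l 2 kj)) e modn_dvdm // dvdn_exp2l.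
Qed.

Lemma crowded_residues : crowded_family (range pow2_residue).
Proof.
move=> s x M sC.
have [K KP] : exists K, forall c, c \in s -> exists2 k, k <= K & pow2_residue k = c.
  elim: s sC => [|c s IH] sC; first by exists 0.
  have [|K KP] := IH; first by move=> d ds; apply: sC; rewrite inE ds orbT.
  have [k _ kc] := sC c (mem_head _ _).
  exists (maxn k K) => d; rewrite inE => /orP[/eqP->|/KP[j jK <-]].
    by exists k => //; exact: leq_maxl.
  by exists j => //; rewrite leq_max jK orbT.
(* Adding a multiple of the largest modulus [2 ^ K] changes none of the residues in [s]. *)
exists (x + 2 ^ K * M.+1); split => //.
  by rewrite (leq_trans _ (leq_addl _ _)) // leq_pmull // expn_gt0.
apply/allP => c /KP[k kK <-]; apply/eqP; apply: (pow2_residue_le kK).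
by rewrite /pow2_residue mulnC addnC modnMDl.
Qed.

Lemma crowded_fibres_setU1 C c :
  crowded_fibres C c -> crowded_family (c |` C).
Proof.
move=> Cc s x M /over_setU1[s' s'C s'P].
by have [y [My xy cxy]] := Cc s' x M s'C; exists y; split => //; exact: s'P.
Qed.

(** * Adding one coloring *)

Section Step.
Variable C : set (nat -> nat).
Hypothesis residuesC : range pow2_residue `<=` C.
Hypothesis crowdedC : crowded_family C.

(** Density is applied near a point [z] beyond [M], within its class modulo [2 ^ z], which has no
    member below [z]. *)
Lemma coloring_dense_unbounded D s x M : coloring_dense C D -> over_family C s ->
  exists y, [/\ M < y, agree s x y & D y].
Proof.
move=> DC sC; have [z [Mz xz _]] := crowdedC x M sC.
have [|y Dy /= /andP[/eqP yz zy]] := DC (pow2_residue z :: s) z.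
  by apply: over_cons => //; apply: residuesC; exists z.
exists y; split=> //; last exact: agree_trans zy.
exact: leq_trans Mz (pow2_residue_ge _ yz).
Qed.

(** Equivalent here to nowhere dense; allowing finite exceptions suits unions of finite layers. *)
Definition thin (P : set nat) : Prop :=
  forall s x, over_family C s -> exists s' x' M,
    [/\ over_family C s', agree s x x', (forall y, agree s' x' y -> agree s x y) &
        forall y, agree s' x' y -> P y -> y <= M].

Lemma coloring_dense_setD D P : coloring_dense C D -> thin P -> coloring_dense C (D `\` P).
Proof.
move=> DC Pthin s x sC; have [s' [x' [M [s'C xx' s's PM]]]] := Pthin s x sC.
have [y [My xy Dy]] := coloring_dense_unbounded x' M DC s'C.
exists y; last exact: s's.
by split=> // /(PM y xy); rewrite leqNgt My.
Qed.

Definition spread (D : nat -> set nat) (P : set nat) (z : nat) (g : nat -> nat)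
    (k : nat) : set nat :=
  [set y | [/\ y <= g k, pow2_residue k y = pow2_residue k z, D k y & ~ P y]].

(** The spread accumulates at [z] only: in the class of some [w > z] modulo [2 ^ w], only the finite
    layers [k < w] can occur. *)
Lemma thin_spread D P z g : thin P -> thin (P `|` \bigcup_k spread D P z g k).
Proof.
move=> Pthin s x sC; have [s' [x' [M [s'C xx' s's PM]]]] := Pthin s x sC.
have [w [zw x'w _]] := crowdedC x' z s'C.
exists (pow2_residue w :: s'), w, (M + \sum_(k < w) g k).
split.
- by apply: over_cons => //; apply: residuesC; exists w.
- exact: s's.
- by move=> y /= /andP[_ wy]; apply: s's; apply: agree_trans wy.
move=> y /= /andP[/eqP yw wy] [Py|[k _ [yg yz _ _]]].
  by rewrite (leq_trans _ (leq_addr _ _)) //; apply: PM => //; exact: agree_trans wy.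
have kw : k < w.
  rewrite ltnNge; apply/negP => wk.
  have /(pow2_residue_ge (leqnn w)) : pow2_residue w z = pow2_residue w w.
    by rewrite -yw; apply/esym; exact: pow2_residue_le yz.
  by rewrite leqNgt zw.
rewrite (leq_trans yg) // (leq_trans _ (leq_addl _ _)) //.
by rewrite (bigD1 (Ordinal kw)) //= leq_addr.
Qed.

Hypothesis smallC : small_family C.

(* The points [f s k] of [D k] in the neighborhood of [z] given by [s] and the
   residue modulo [2 ^ k] form a family of functions too small to be dominating. *)
Lemma spread_meets_neighborhoods D P z : (forall k, coloring_dense C (D k)) -> thin P ->
  exists g, forall s, over_family C s -> exists k y, spread D P z g k y /\ agree s z y.
Proof.
move=> DC Pthin.
have /choice[f fP] (s : seq (nat -> nat)) : exists h : nat -> nat, over_family C s -> forall k,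
    [/\ pow2_residue k (h k) = pow2_residue k z, agree s z (h k), D k (h k) & ~ P (h k)].
  have [sC|] := pselect (over_family C s); last by exists (fun=> 0).
  suff /choice[h hP] : forall k, exists y,
    [/\ pow2_residue k y = pow2_residue k z, agree s z y, D k y & ~ P y] by exists h.
  move=> k.
  have [|y [Dy Py] /= /andP[/eqP ky zy]] :=
    coloring_dense_setD (DC k) Pthin (s := pow2_residue k :: s) z.
    by apply: over_cons => //; apply: residuesC; exists k.
  by exists y.
(* No [f s] dominates [g], so for each [s] some point [f s k] is below the bound [g k]. *)
have /existsNP[g gP] := @smallC f.
exists g => s sC; apply: contrapT => nks; apply: gP.
exists (f s); first by exists s.
rewrite /eventually_le; suff -> : [set n | ~~ (g n <= f s n)] = set0 by [].
apply/seteqP; split=> // k /=; rewrite -ltnNge => /ltnW fg; apply: nks.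
by exists k, (f s k); have [] := fP s sC k.
Qed.

(* At stage [n] a spread at [z] is given the color [i], where [n] codes the pair
   [(z, i)]; it avoids the previous stages and is chosen in the tail of [D] from
   [n] on, so that only finitely many points are taken in each [D m].  The points
   never taken get pairwise distinct colors. *)
Lemma selecting_coloring D : (forall k, coloring_dense C (D k)) ->
  exists2 c, crowded_fibres C c & selects D c.
Proof.
move=> DC.
pose point n : nat := if @unpickle (nat * nat)%type n is Some p then p.1 else 0.
pose color n : nat := if @unpickle (nat * nat)%type n is Some p then p.2 else 0.
have /choice[G GP] (q : nat * set nat) : exists g, thin q.2 -> forall s, over_family C s ->
    exists k y, spread (fun k => D (q.1 + k)) q.2 (point q.1) g k y /\ agree s (point q.1) y.
  have [Pthin|] := pselect (thin q.2); last by exists (fun=> 0).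
  have [|g gP] := @spread_meets_neighborhoods (fun k => D (q.1 + k)) q.2 (point q.1) _ Pthin.
    by move=> k; exact: DC.
  by exists g.
pose N n P := spread (fun k => D (n + k)) P (point n) (G (n, P)).
pose fix P n : set nat :=
  if n is m.+1 then P m `|` \bigcup_k N m (P m) k else set0.
have Pthin n : thin (P n).
  elim: n => [|n IH]; last exact: thin_spread.
  by move=> s x sC; exists s, x, 0; split => //; exact: agree_refl.
have Pmono m n : m <= n -> P m `<=` P n.
  move=> /subnKC <-; elim: (n - m) => [|k IH]; first by rewrite addn0.
  by rewrite addnS => x /IH; left.
pose E n := \bigcup_k N n (P n) k.
have EP m n : m < n -> E m `<=` P n.
  by move=> mn x Ex; apply: (Pmono _ _ mn); right.
have Euniq m n x : E m x -> E n x -> m = n.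
  move=> Em En; case: (ltngtP m n) => // lt.
  - by have [k _ [_ _ _]] := En; case; exact: EP Em.
  - by have [k _ [_ _ _]] := Em; case; exact: EP En.
have /choice[c cP] x : exists i, (forall n, E n x -> i = color n) /\
    ((forall n, ~ E n x) -> i = x).
  have [[n En]|nE] := pselect (exists n, E n x).
    by exists (color n); split=> [m /(Euniq _ _ _ En)->//|/(_ n)].
  by exists x; split=> // n En; case: nE; exists n.
exists c.
  move=> s x M sC; have [z [Mz xz _]] := crowdedC x M sC.
  pose n := pickle (z, c x).
  have [pn cn] : point n = z /\ color n = c x by rewrite /point /color /n pickleK.
  have [|k [y [Ny zy]]] := GP (n, P n) (Pthin n) (pow2_residue z :: s).
    by apply: over_cons => //; apply: residuesC; exists z.
  move: zy => /= /andP[/eqP]; rewrite pn => yz zy.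
  exists y; split; first exact: leq_trans Mz (pow2_residue_ge _ yz).
    exact: agree_trans zy.
  by rewrite -cn; apply: (cP y).1; exists k.
(* Layer [k] of stage [n] lies in [D (n + k)], so [F m] collects the layers with [n + k = m]. *)
pose F m := [set y | exists2 n, n <= m & N n (P n) (m - n) y].
exists F.
  move=> m; split; last first.
    by move=> y [n nm [_ _ + _]]; rewrite subnKC.
  apply: (@sub_finite_set _ _ `I_(\sum_(n < m.+1) G (nat_of_ord n, P n) (m - n)).+1) => //.
  move=> y [n nm [yG _ _ _]] /=; rewrite ltnS (leq_trans yG) //.
  by rewrite (bigD1 (Ordinal (nm : n < m.+1))) //= leq_addr.
have EF n x : E n x -> (\bigcup_m F m) x.
  by move=> [k _ Nx]; exists (n + k) => //; exists n; rewrite ?leq_addr // addKn.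
move=> x y nx ny; rewrite (cP x).2; last by move=> n /EF.
by rewrite (cP y).2 // => n /EF.
Qed.

(** A task serves two purposes: as a sequence of dense sets if it is one, otherwise as its first
    set, to be made clopen if crowdedness permits. *)
Definition handles (D : nat -> set nat) (c : nat -> nat) : Prop :=
  [/\ crowded_fibres C c, (forall k, coloring_dense C (D k)) -> selects D c &
      ~ (forall k, coloring_dense C (D k)) -> crowded_fibres C (membership (D 0)) ->
      c = membership (D 0)].

Lemma handles_exists D : exists c, handles D c.
Proof.
have [DC|nDC] := pselect (forall k, coloring_dense C (D k)).
  by have [c cC cD] := selecting_coloring DC; exists c; split.
have [dC|ndC] := pselect (crowded_fibres C (membership (D 0))).
  by exists (membership (D 0)); split.
by exists (fun=> 0); split.
Qed.

End Step.

(** * The transfinite recursion *)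

Definition residues_and (T : Type) (c : T -> nat -> nat) (L : set T) :
    set (nat -> nat) :=
  range pow2_residue `|` c @` L.

Lemma residues_andS (T : Type) (c : T -> nat -> nat) (L M : set T) :
  L `<=` M -> residues_and c L `<=` residues_and c M.
Proof. by move=> LM; apply: setUS; exact: image_subset. Qed.

Lemma over_residues_and (T : Type) (lt : T -> T -> Prop) (c : T -> nat -> nat)
    (L : set T) s :
  strict_well_order lt -> over_family (residues_and c L) s ->
  over_family (range pow2_residue) s \/
  exists2 u, L u & over_family (c u |` residues_and c [set v | lt v u]) s.
Proof.
move=> [_ tr tri]; elim: s => [|a s IH] h; first by left.
have {IH}[|s0|[u Lu su]] := IH; first by move=> d ds; apply: h; rewrite inE ds orbT.
- have [a0|[u Lu ua]] := h a (mem_head _ _); first by left; exact: over_cons.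
  right; exists u => //; apply: over_cons; first by left.
  by apply: overS s0 => d d0; right; left.
- right; have [a0|[v Lv va]] := h a (mem_head _ _).
    by exists u => //; apply: over_cons su; right; left.
  have [uv|uv|vu] := tri u v.
  + exists v => //; apply: over_cons; first by left.
    apply: overS su => d [->|[d0|[w wu <-]]]; right; [right|by left|right].
      by exists u.
    by exists w => //; exact: tr wu uv.
  + by exists u => //; apply: over_cons su; left; rewrite uv va.
  + by exists u => //; apply: over_cons su; right; right; exists v.
Qed.

(** Crowdedness concerns finite sequences, so it follows from the step at the largest index used,
    also at limits. *)
Lemma crowded_residues_and (T : Type) (lt : T -> T -> Prop) (c : T -> nat -> nat)
    (L : set T) :
  strict_well_order lt ->
  (forall u, L u -> crowded_fibres (residues_and c [set v | lt v u]) (c u)) ->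
  crowded_family (residues_and c L).
Proof.
move=> wo cL s x M /(over_residues_and wo)[s0|[u Lu su]].
  exact: crowded_residues.
exact: crowded_fibres_setU1 (cL u Lu) _ _ _ su.
Qed.

(** If the image of [f] were dominating, all tasks would inject into it; coding preimages under [f]
    as words over [L] would then embed the tasks in these words. *)
Lemma small_residues_and (R : realType) (c : (nat -> set nat) -> nat -> nat)
    (L : set (nat -> set nat)) :
  (forall G, dominating G -> ([set: R] #<= G)%card) ->
  ~ embeds_in_words L -> small_family (residues_and c L).
Proof.
move=> hd nL f /hd/pcard_leP[e]; apply: nL.
have [i iI] := set_sequences_embed_reals R.
pose decode (l : nat + (nat -> set nat)) :=
  match l with inl k => pow2_residue k | inr u => c u end.
have wordP s : over_family (residues_and c L) s ->
    exists2 w, (forall u, inr u \in w -> L u) & s = map decode w.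
  elim: s => [|a s IH] h; first by exists [::].
  have [|w wL ->] := IH; first by move=> d ds; apply: h; rewrite inE ds orbT.
  have [[k _ <-]|[u Lu <-]] := h a (mem_head _ _).
    by exists (inl k :: w).
  by exists (inr u :: w) => // v; rewrite inE => /orP[/eqP[->]|/wL].
have /choice[w wP] (D : nat -> set nat) : exists w, (forall u, inr u \in w -> L u) /\
    e (i D) = f (map decode w).
  have [s /wordP[w wL ->] <-] : (f @` over_family (residues_and c L)) (e (i D)).
    exact: (@funS _ _ _ _ e).
  by exists w.
exists w; last by move=> D u /(wP D).1.
move=> D D' ww; apply: iI; have := (wP D').2; rewrite -ww -(wP D).2 => /esym.
by apply: (@inj _ _ [set: R] e); rewrite inE.
Qed.

Lemma crowded_fibresS C C' c : C `<=` C' -> crowded_fibres C' c -> crowded_fibres C c.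
Proof. by move=> CC' h s x M sC; apply: h; exact: overS CC' sC. Qed.

Lemma coloring_denseS C C' D : C `<=` C' -> coloring_dense C' D -> coloring_dense C D.
Proof. by move=> CC' h s x sC; apply: h; exact: overS CC' sC. Qed.

Definition saturated (C : set (nat -> nat)) : Prop :=
  [/\ range pow2_residue `<=` C, crowded_family C,
      forall D, (forall k, coloring_dense C (D k)) -> exists2 c, C c & selects D c &
      forall A, crowded_fibres C (membership A) -> C (membership A)].

Lemma saturated_family_exists (R : realType) :
  (forall G, dominating G -> ([set: R] #<= G)%card) -> exists C, saturated C.
Proof.
move=> hd.
have [lt wo small] := small_segments_well_order not_embeds_in_words_set0.
have [wf _ _] := wo.
(* The default, constant 0, makes the recursion total; [cP] shows by induction that a handling
   coloring always exists. *)
pose pick C D : nat -> nat := xget (fun=> 0) [set c | handles C D c].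
pose step D (rec : forall D', lt D' D -> nat -> nat) : nat -> nat :=
  pick (range pow2_residue `|` [set d | exists D' (h : lt D' D), rec D' h = d]) D.
pose c : (nat -> set nat) -> nat -> nat := Fix wf (fun=> nat -> nat) step.
have cE D : c D = pick (residues_and c [set D' | lt D' D]) D.
  rewrite {1}/c Fix_eq; last first.
    move=> D1 f g fg; congr step; apply/functional_extensionality_dep => D2.
    by apply/functional_extensionality_dep => h; exact: fg.
  congr (pick (_ `|` _) D); apply/seteqP; split=> d.
    by move=> [D' [h <-]]; exists D'.
  by move=> [D' h <-]; exists D', h.
have cP D : handles (residues_and c [set D' | lt D' D]) D (c D).
  elim/(well_founded_ind wf): D => D IH.
  rewrite cE; apply: (@xgetPex _ (fun=> 0) (handles _ D)); apply: handles_exists.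
  - by move=> d; left.
  - by apply: (crowded_residues_and wo) => D1 /IH[].
  - exact: small_residues_and hd (small D).
have sub D : residues_and c [set D' | lt D' D] `<=` residues_and c setT.
  exact: residues_andS.
exists (residues_and c setT); split.
- by move=> d; left.
- by apply: (crowded_residues_and wo) => D _; have [] := cP D.
- move=> D DC; exists (c D); first by right; exists D.
  by have [_ + _] := cP D; apply=> k; exact: coloring_denseS (DC k).
(* The empty terms keep [D] from being a sequence of dense sets, so its task is to add
   [membership A]. *)
- move=> A AC; pose D n := if n is 0 then A else set0.
  have [_ _ cD] := cP D; right; exists D => //; apply: cD.
    by move=> /(_ 1 [::] 0 (@over_nil _))[].
  exact: crowded_fibresS AC.
Qed.

(** * Dense sets, crowded sets and selections in a saturated family *)

Section Saturated.
Variable C : set (nat -> nat).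
Hypothesis saturatedC : saturated C.

Let residuesC : range pow2_residue `<=` C. Proof. by case: saturatedC. Qed.
Let crowdedC : crowded_family C. Proof. by case: saturatedC. Qed.

Lemma residue_separates x y :
  agree [:: pow2_residue (maxn x y)] x y -> x = y.
Proof.
move=> /= /andP[/eqP xy _]; apply/eqP; rewrite eqn_leq.
by rewrite (pow2_residue_ge _ xy) ?leq_maxl // (pow2_residue_ge _ (esym xy)) ?leq_maxr.
Qed.

Lemma over_residue k : over_family C [:: pow2_residue k].
Proof. by move=> d; rewrite inE => /eqP->; apply: residuesC; exists k. Qed.

Definition coloring_open (O : set nat) : Prop :=
  forall x, O x -> exists2 s, over_family C s & forall y, agree s x y -> O y.

(** The color class of [x] has at most one point off the selected part of [D]. If this point is not
    [x], a residue cuts it off; otherwise the class lies in [D]. *)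
Lemma saturated_dense_open D : coloring_dense C D -> coloring_open D.
Proof.
move=> DC x Dx; have [_ _ sel _] := saturatedC.
have [c cC [F FD cF]] := sel (fun=> D) (fun=> DC).
have FE y : (\bigcup_n F n) y -> D y by move=> [n _]; exact: (FD n).2.
have cs : over_family C [:: c] by apply: over_cons => //; exact: over_nil.
have [[x0 [nx0 cx0 xx0]]|nx0] :=
  pselect (exists x0, [/\ ~ (\bigcup_n F n) x0, c x0 = c x & x <> x0]).
- exists ([:: c] ++ [:: pow2_residue (maxn x x0)]).
    exact: over_cat (@over_residue _).
  move=> y; rewrite agree_cat => /andP[/= /andP[/eqP cy _] xy].
  have [/FE//|ny] := pselect ((\bigcup_n F n) y).
  have yx0 : y = x0 by apply: cF => //; rewrite cy.
  by case: xx0; apply: residue_separates; rewrite -{2}yx0.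
- exists [:: c] => // y /= /andP[/eqP cy _].
  have [/FE//|ny] := pselect ((\bigcup_n F n) y).
  have [<-//|xy] := pselect (x = y).
  by case: nx0; exists y.
Qed.

Lemma saturated_crowded_open A :
  (forall s x M, over_family C s -> A x -> exists y, [/\ M < y, agree s x y & A y]) ->
  coloring_open A.
Proof.
move=> Acr x Ax; have [_ _ _ ind] := saturatedC.
(* The closure of [A]: it and its open complement are crowded, so it becomes clopen. *)
pose K : set nat := [set z | forall s, over_family C s -> exists2 y, A y & agree s z y].
have AK : A `<=` K by move=> y Ay s sC; exists y => //; exact: agree_refl.
have KC : C (membership K).
  apply: ind => s z M sC; rewrite /membership.
  have [Kz|nKz] := pselect (K z).
    have [y Ay zy] := Kz s sC; have [y' [My' yy' Ay']] := Acr s y M sC Ay.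
    exists y'; split=> //; first exact: agree_trans yy'.
    by rewrite !asboolT //; exact: AK.
  have /existsNP[s0 /not_implyP[s0C nA]] := nKz.
  have [y [My + _]] := crowdedC z M (over_cat s0C sC).
  rewrite agree_cat => /andP[zy0 zy]; exists y; split=> //.
  rewrite !asboolF // => Ky; apply: nA.
  by have [w Aw yw] := Ky s0 s0C; exists w => //; exact: agree_trans yw.
have [|s sC sA] := @saturated_dense_open (A `|` ~` K) _ x (or_introl Ax).
  move=> s z sC; have [Kz|nKz] := pselect (K z).
    by have [y Ay zy] := Kz s sC; exists y => //; left.
  by exists z; [right|exact: agree_refl].
exists (membership K :: s); first exact: over_cons.
move=> y /= /andP[/eqP Ky /sA[//|nKy]].
by move: Ky; rewrite /membership asboolF // asboolT //; exact: AK.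
Qed.

(** Every neighborhood of [x] has two points [y < z] of the color of [x], and they cannot both be
    off the union. *)
Lemma saturated_selection D : (forall n, coloring_dense C (D n)) ->
  exists F : nat -> set nat, (forall n, finite_set (F n) /\ F n `<=` D n) /\
    coloring_dense C (\bigcup_n F n).
Proof.
have [_ _ sel _] := saturatedC.
move=> /sel[c cC [F FD cF]]; exists F; split=> // s x sC.
have csC : over_family C (c :: s) by exact: over_cons.
have [y [_ xy _]] := crowdedC x 0 csC.
have [z [yz xz _]] := crowdedC x y csC.
have [Fy|nFy] := pselect ((\bigcup_n F n) y).
  by exists y => //; move: xy => /= /andP[].
have [Fz|nFz] := pselect ((\bigcup_n F n) z).
  by exists z => //; move: xz => /= /andP[].
move: xy xz => /= /andP[/eqP cy _] /andP[/eqP cz _].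
suff e : y = z by rewrite e ltnn in yz.
by apply: cF => //; rewrite cy cz.
Qed.

End Saturated.

(** * The topological space *)

(** An alias of [nat] indexed by [C], so that each family carries its own topology. *)
Definition coloring_space (C : set (nat -> nat)) : Type := nat.

HB.instance Definition _ (C : set (nat -> nat)) :=
  Choice.copy (coloring_space C) nat.

Section ColoringSpace.
Variable C : set (nat -> nat).

Let coloring_openT : coloring_open C setT.
Proof. by move=> x _; exists [::] => //; exact: over_nil. Qed.

Let coloring_openI : setI_closed (coloring_open C).
Proof.
move=> A B oA oB x [/oA[s sC sA] /oB[s' s'C s'B]].
exists (s ++ s'); first exact: over_cat.
by move=> y; rewrite agree_cat => /andP[/sA Ay /s'B By].
Qed.

Let coloring_open_bigU (I : Type) (f : I -> set nat) :
  (forall i, coloring_open C (f i)) -> coloring_open C (\bigcup_i f i).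
Proof.
move=> of_ x [i _ /of_[s sC sf]]; exists s => // y /sf fy; by exists i.
Qed.

HB.instance Definition _ :=
  isOpenTopological.Build (coloring_space C)
    coloring_openT coloring_openI coloring_open_bigU.

Local Notation X := (coloring_space C).

Lemma coloring_openE (O : set X) : open O = coloring_open C O.
Proof. by []. Qed.

Lemma open_agree s (x : X) : over_family C s -> open ([set y | agree s x y] : set X).
Proof.
by rewrite coloring_openE => sC y xy; exists s => // z yz; exact: agree_trans yz.
Qed.

Lemma nbhs_coloringP (x : X) (A : set X) :
  nbhs x A <-> exists2 s, over_family C s & forall y, agree s x y -> A y.
Proof.
rewrite nbhsE; split=> [[V [oV Vx] VA]|[s sC sA]].
  rewrite coloring_openE in oV.
  by have [s sC sV] := oV x Vx; exists s => // y /sV/VA.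
exists [set y | agree s x y] => //; split; last exact: agree_refl.
exact: open_agree.
Qed.

Lemma dense_coloringP (D : set X) : dense D <-> coloring_dense C D.
Proof.
split=> [dD s x sC|DC O [x Ox]].
  have [|y [xy Dy]] := dD _ _ (@open_agree s x sC).
    by exists x; exact: agree_refl.
  by exists y.
rewrite coloring_openE => /(_ x Ox)[s sC sO]; have [y Dy xy] := DC s x sC.
by exists y; split=> //; exact: sO.
Qed.

Hypothesis saturatedC : saturated C.

Lemma coloring_space_accessible : accessible_space X.
Proof.
move=> x y /eqP xy; exists [set z | agree [:: pow2_residue (maxn x y)] x z].
split; first by apply: open_agree; exact: over_residue.
  by rewrite inE; exact: agree_refl.
by rewrite inE => /residue_separates.
Qed.

Lemma coloring_space_regular : regular_space X.
Proof.
move=> x U /nbhs_coloringP[s sC sU].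
exists [set y | agree s x y]; first by apply/nbhs_coloringP; exists s.
move=> y /(_ [set z | agree s y z])[|z [xz yz]].
  by apply/nbhs_coloringP; exists s.
by apply: sU; apply: agree_trans xz _; exact: agree_sym.
Qed.

Lemma coloring_space_crowded : crowded X.
Proof.
have [_ cr _ _] := saturatedC.
apply/seteqP; split=> // x [_ [V /nbhs_coloringP[s sC sV] Vx]].
have [y [xy sxy _]] := cr s x x sC.
have : (V `&` setT) y by split=> //; exact: sV.
by rewrite Vx => /= e; rewrite e ltnn in xy.
Qed.

Lemma coloring_space_maximal : maximal_space X.
Proof.
have [res _ _ _] := saturatedC.
split; first exact: coloring_space_crowded.
move=> [tau]; set Y := Topological.Pack tau => -[[XY nYX] crY].
apply: nYX => A oA; rewrite coloring_openE; apply: (saturated_crowded_open saturatedC) => s x M sC Ax.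
(* With this [k], a point [y <= M] congruent to [x] modulo [2 ^ k] equals [x]. *)
pose k := maxn x M.
have ksC : over_family C (pow2_residue k :: s) by apply: over_cons => //; apply: res; exists k.
pose W : set Y := A `&` [set y | agree (pow2_residue k :: s) x y].
have oW : open W by apply: openI => //; apply: XY; exact: open_agree.
have Wx : W x by split=> //; exact: agree_refl.
have [y [Ay xy] yx] : exists2 y, W y & y <> x.
  apply: contrapT => noy.
  suff : isolated [set: Y] x by rewrite crY.
  split; first by rewrite inE.
  exists W; first exact: open_nbhs_nbhs.
  rewrite setIT; apply/seteqP; split=> [y Wy|y ->//].
  by apply: contrapT => yx; apply: noy; exists y.
exists y; split=> //; last by move: xy => /= /andP[].
move: xy => /= /andP[/eqP xy _]; rewrite ltnNge; apply/negP => yM.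
apply: yx; apply: (@anti_leq y x); rewrite (pow2_residue_ge _ xy) ?leq_maxl //.
by rewrite (pow2_residue_ge _ (esym xy)) // leq_max yM orbT.
Qed.

Lemma coloring_space_selectively_separable : selectively_separable X.
Proof.
move=> D dD; have [|F [FD dF]] := @saturated_selection C saturatedC D.
  by move=> n; exact/dense_coloringP.
by exists F; split=> //; exact/dense_coloringP.
Qed.

End ColoringSpace.

Theorem theorem67 (R : realType) (hdc : dominating_number_eq_continuum R) :
  exists X : topologicalType,
    [set: X] !=set0 /\ countable [set: X] /\
    regular_space X /\ accessible_space X /\
    maximal_space X /\ selectively_separable X.
Proof.
have [C saturatedC] := saturated_family_exists hdc.2.
exists (coloring_space C : topologicalType); do ! split.
- by exists (0 : nat).
- exact: (@countableP nat).
- exact: coloring_space_regular.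
- exact: coloring_space_accessible.
- exact: coloring_space_crowded.
- exact: (coloring_space_maximal saturatedC).2.
- exact: coloring_space_selectively_separable.
Qed.
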